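(* Let $G$ be an infinite graph (not necessarily connected) of bounded vertex degrees, i.e. there is an integer $d>0$ such that every vertex of $G$ has degree at most $d$. If $G$ is uniformly locally amenable, then $G$ is of Property A.
   Context: For an infinite graph $S$, let $\mathcal{G}_S$ denote the class of all finite (nonempty) subgraphs of $S$ (all subgraphs, not only induced ones). Uniform local amenability. For a finite graph $F$ and $E\subset V(F)$, let $\partial(E)=\partial_F(E)$ denote the set of vertices in $E$ which are adjacent in $F$ to some vertex not in $E$. A class $\mathcal{G}$ of finite graphs is uniformly locally amenable if for every $\epsilon>0$ there exists $K>0$ such that for every $F\in\mathcal{G}$ there is a nonempty subset $E\subset V(F)$ with $|E|\le K$ and $|\partial_F(E)|\le\epsilon|E|$. An infinite graph $S$ is uniformly locally amenable if the class $\mathcal{G}_S$ is uniformly locally amenable. Property A (in the form of local weighted hyperfiniteness). A finite graph $F$ is weighted $(\epsilon,K)$-hyperfinite if for every nonnegative function $w:V(F)\to\mathbb{R}$ there is a subset $Y\subset V(F)$ such that $\sum_{y\in Y}w(y)\le\epsilon\sum_{x\in V(F)}w(x)$ and, after removing $Y$ from $V(F)$ together with all incident edges, all connected components of the resulting graph have at most $K$ vertices. A class $\mathcal{G}$ of finite graphs is weighted hyperfinite if for every $\epsilon>0$ there exists $K>0$ such that every $F\in\mathcal{G}$ is weighted $(\epsilon,K)$-hyperfinite. An infinite graph $S$ is of Property A if the class $\mathcal{G}_S$ is weighted hyperfinite. *)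

(* Defs.v *)
From mathcomp Require Import all_boot all_order all_algebra.
From mathcomp Require Import finmap.
From mathcomp Require Import boolp classical_sets functions cardinality reals.

Set Implicit Arguments.
Unset Strict Implicit.
Unset Printing Implicit Defensive.

Import Order.TTheory GRing.Theory Num.Theory.

Local Open Scope classical_set_scope.
Local Open Scope card_scope.
Local Open Scope ring_scope.

Record graph := Graph {
  vertex :> choiceType;
  adj : vertex -> vertex -> Prop;
  adj_sym : forall x y, adj x y -> adj y x;
  adj_irr : forall x, ~ adj x x
}.

Record fin_graph := FinGraph {
  fvertex :> finType;
  fadj : rel fvertex;
  fadj_sym : symmetric fadj;
  fadj_irr : irreflexive fadj
}.

Definition neighbours (S : graph) (x : S) : set S := [set y | adj x y].

Definition degree_le (S : graph) (d : nat) : Prop :=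
  forall x : S, neighbours x #<= `I_d.

Definition infinite_graph (S : graph) : Prop := infinite_set [set: S].

(* The edges form any symmetric subset of those that S has between the chosen
   vertices: subgraphs need not be induced. *)
Record fsubgraph (S : graph) := FSubgraph {
  sub_vertex : {fset S};
  sub_adj : rel sub_vertex;
  sub_adj_sym : symmetric sub_adj;
  sub_adjP : forall x y, sub_adj x y -> adj (val x) (val y)
}.

Arguments sub_adj {S} _ _ _.

Lemma sub_adj_irr (S : graph) (H : fsubgraph S) : irreflexive (sub_adj H).
Proof. by move=> x; apply/negP => /sub_adjP /adj_irr. Qed.

Definition fin_graph_of_sub (S : graph) (H : fsubgraph S) : fin_graph :=
  FinGraph (@sub_adj_sym S H) (@sub_adj_irr S H).

Definition finite_subgraphs (S : graph) (F : fin_graph) : Prop :=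
  exists H : fsubgraph S, sub_vertex H != fset0%fset /\ F = fin_graph_of_sub H.

Definition boundary (F : fin_graph) (E : {set F}) : {set F} :=
  [set x in E | [exists y, (y \notin E) && fadj x y]]%SET.

Definition uniformly_locally_amenable (R : realType) (C : fin_graph -> Prop) :
    Prop :=
  forall eps : R, 0 < eps ->
  exists2 K : nat, (0 < K)%N & forall F : fin_graph, C F ->
  exists E : {set F},
    [/\ E != finset.set0, (#|E| <= K)%N
      & #|boundary E|%:R <= eps * #|E|%:R].

(* Adjacency after deleting Y: the vertices of Y are kept as isolated points,
   so only the components of vertices outside Y are meaningful. *)
Definition del_adj (F : fin_graph) (Y : {set F}) : rel F :=
  [rel x y | [&& x \notin Y, y \notin Y & fadj x y]].

Definition components_le (F : fin_graph) (Y : {set F}) (K : nat) : Prop :=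
  forall x : F, x \notin Y -> (#|connect (del_adj Y) x| <= K)%N.

Definition weighted_hyperfinite_graph (R : realType) (eps : R) (K : nat)
    (F : fin_graph) : Prop :=
  forall w : F -> R, (forall x, 0 <= w x) ->
  exists2 Y : {set F},
    \sum_(y in Y) w y <= eps * \sum_(x : F) w x & components_le Y K.

Definition weighted_hyperfinite (R : realType) (C : fin_graph -> Prop) :
    Prop :=
  forall eps : R, 0 < eps ->
  exists2 K : nat, (0 < K)%N & forall F : fin_graph, C F ->
  weighted_hyperfinite_graph eps K F.

Definition graph_ULA (R : realType) (S : graph) : Prop :=
  uniformly_locally_amenable R (finite_subgraphs S).

Definition property_A (R : realType) (S : graph) : Prop :=
  weighted_hyperfinite R (finite_subgraphs S).

(* Main.v *)
Require Import Defs.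
From mathcomp Require Import all_boot all_order all_algebra.
From mathcomp Require Import finmap.
From mathcomp Require Import boolp classical_sets functions cardinality reals.
From mathcomp Require Import lra.

(* Subgraphs inherit local amenability, so sets with small boundary can be cut
   off one after the other: every induced subgraph on a set A is separated by
   at most eps |A| vertices, counted without weights.  To treat a weight w,
   sort the vertices into levels with M^l u <= w < M^(l+1) u and delete the
   vertices of weight zero, those with a neighbour at least M times heavier
   (of total weight at most d/M, charged to that neighbour), and the levels in
   one residue class mod L, chosen to cost at most 1/L.  What remains falls
   into blocks of L - 1 consecutive levels with no edge between two blocks.
   Inside a block the weights differ by a factor at most M^L, which depends on
   eps and d only, so the unweighted result with eps / M^L applies. *)

Set Implicit Arguments.
Unset Strict Implicit.
Unset Printing Implicit Defensive.

Import Order.TTheory GRing.Theory Num.Theory.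

Local Open Scope ring_scope.

(** * Unweighted hyperfiniteness from local amenability *)

Definition induced_ULA (R : realType) (F : fin_graph) (eps : R) (K : nat) :
    Prop :=
  forall A : {set F}, A != finset.set0 ->
  exists E : {set F}, [/\ E \subset A, E != finset.set0, (#|E| <= K)%N
    & #|[set x in E | [exists y in A :\: E, fadj x y]]|%:R <= eps * #|E|%:R].

(** The graph that [H] induces on [A] is again a finite subgraph of [G], so it has an amenable set.
    Its vertices form another finite set of [G], hence the transport along [lift]. *)
Lemma ULA_induced (R : realType) (G : graph) (H : fsubgraph G) (eps : R)
    (K : nat) :
  (forall F : fin_graph, finite_subgraphs G F -> exists E : {set F},
    [/\ E != finset.set0, (#|E| <= K)%N
      & #|boundary E|%:R <= eps * #|E|%:R]) ->
  induced_ULA (fin_graph_of_sub H) eps K.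
Proof.
move=> ula A /set0Pn [a0 a0A].
pose V : {fset G} := [fset val x | x in A]%fset.
have /choice [lift liftP] (v : V) :
    exists x : sub_vertex H, x \in A /\ val v = val x.
  by case/imfsetP: (valP v) => x /= xA vx; exists x.
have liftA v : lift v \in A by case: (liftP v).
have val_lift v : val v = val (lift v) by case: (liftP v).
have lift_inj : injective lift.
  by move=> v v' e; apply/val_inj; rewrite !val_lift e.
have liftK x : x \in A -> exists v, lift v = x.
  move=> xA; have xV : val x \in V by apply/imfsetP; exists x.
  by exists [` xV]%fset; apply/val_inj; rewrite -val_lift.
pose e : rel V := fun v v' => sub_adj H (lift v) (lift v').
have e_sym : symmetric e by move=> v v'; exact: sub_adj_sym.
have e_adj v v' : e v v' -> adj (val v) (val v').
  by move=> /sub_adjP; rewrite !val_lift.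
pose H' := FSubgraph e_sym e_adj.
have [|E [E0 EK bE]] := ula (fin_graph_of_sub H').
  exists H'; split=> //; apply/fset0Pn; exists (val a0).
  by apply/imfsetP; exists a0.
have lift_injS (B : {set V}) : #|lift @: B| = #|B| by exact: card_imset.
exists (lift @: E); split.
- by apply/fintype.subsetP => _ /imsetP [v _ ->].
- by rewrite -card_gt0 lift_injS card_gt0.
- by rewrite lift_injS.
- rewrite lift_injS; apply: le_trans bE; rewrite ler_nat -lift_injS.
  apply/subset_leq_card/fintype.subsetP => x.
  rewrite inE => /andP [/imsetP [v vE ->]] /exists_inP [y].
  rewrite !inE => /andP [yE /liftK [v' v'y]] vy.
  apply: imset_f; rewrite inE vE; apply/existsP; exists v'.
  apply/andP; split; last by rewrite /= /e v'y.
  apply: contra yE => v'E.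
  by rewrite -v'y imset_f.
Qed.

Lemma connect_restrict (T : finType) (e e' : rel T) (P : pred T) (x y : T) :
  (forall a b, P a -> e a b -> e' a b /\ P b) ->
  P x -> connect e x y -> connect e' x y /\ P y.
Proof.
move=> step Px /connectP [p pth ->] {y}.
elim: p x Px pth => [|z p IHp] x Px /=; first by rewrite connect0.
case/andP=> /(step _ _ Px) [xz Pz] /(IHp _ Pz) [zp ?]; split=> //.
exact: connect_trans (connect1 xz) zp.
Qed.

(** Induction on [#|A|]: cut off an amenable set [E] by deleting its boundary in [A], then treat
    [A :\: E]. The costs add up because [E] and [A :\: E] partition [A]. *)
Lemma greedy_hyperfinite (R : realType) (F : fin_graph) (eps : R) (K : nat) :
  0 <= eps -> induced_ULA F eps K -> forall A : {set F},
  exists Y : {set F}, [/\ Y \subset A, #|Y|%:R <= eps * #|A|%:R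
    & components_le (Y :|: ~: A) K].
Proof.
move=> eps0 ula A; have [n] := ubnP #|A|.
elim: n A => // n IHn A; rewrite ltnS => An.
have [->|A0] := eqVneq A finset.set0.
  exists finset.set0; split; rewrite ?sub0set ?cards0 ?mulr0 //.
  by move=> x; rewrite !inE.
have [E [EA E0 EK bE]] := ula _ A0.
set D := [set x in E | _] in bE.
have cardA : #|A| = (#|A :\: E| + #|E|)%N.
  by rewrite addnC -{1}(finset.setIidPr EA) cardsID.
have [|Y [YA cY compY]] := IHn (A :\: E).
  by apply: leq_trans An; rewrite cardA -[ltnLHS]addn0 ltn_add2l card_gt0.
exists (Y :|: D); split.
- rewrite finset.subUset (fintype.subset_trans YA) ?finset.subsetDl //=.
  apply: fintype.subset_trans EA; apply/fintype.subsetP => x.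
  by rewrite inE => /andP [].
- apply: le_trans (_ : #|Y|%:R + #|D|%:R <= _).
    by rewrite -natrD ler_nat cardsU leq_subr.
  by rewrite cardA natrD mulrDr lerD.
(* An undeleted vertex of [E] is not in [D], so its neighbours in [A] lie in [E]: the component of
   [x] stays inside [E]. *)
- move=> x xY; have [xE|xE] := boolP (x \in E).
    apply: leq_trans EK; apply/subset_leq_card/fintype.subsetP => y.
    rewrite inE => xy; move: xE.
    have := @connect_restrict _ _ (del_adj (Y :|: D :|: ~: A)) (mem E) x y
      _ _ xy.
    move=> H xE; apply: (proj2 (H _ xE)) => a b /= aE ab; split=> //.
    move: ab; rewrite /del_adj /= !inE aE /= => /and3P [].
    rewrite !negb_or => /andP [/andP [_ /exists_inPn nab] _] /andP [_ ].
    rewrite negbK => bA; apply: contraTT => bE'; apply: nab.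
    by rewrite !inE bE' bA.
  (* A path starting in [A :\: E] cannot enter [E], since the first vertex reached there would be in
     [D]; the component survives from the induction hypothesis. *)
  have xY' : x \notin Y :|: ~: (A :\: E).
    by move: xY; rewrite !inE !negb_or !negbK xE => /andP [/andP [-> _] ->].
  apply: leq_trans (compY x xY'); apply/subset_leq_card/fintype.subsetP => y.
  rewrite !inE => xy.
  apply: (proj1 (@connect_restrict _ _ _ (fun a => a \notin E) x y _ xE xy)).
  move=> a b /= aE; rewrite /del_adj /= !inE !negb_or !negbK aE /=.
  move=> /and3P [/andP [/andP [-> _] aA] /andP [/andP [-> bD] bA] ab].
  suff bE' : b \notin E by rewrite aA bE' bA ab.
  apply: contra bD => bE'; rewrite bE'; apply/exists_inP; exists a.
    by rewrite !inE aE.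
  by rewrite fadj_sym.
Qed.

(** * Weighted sums and independent blocks *)

Lemma sum_union_le (R : realType) (F : finType) (w : F -> R) (A B : {set F}) :
  (forall x, 0 <= w x) ->
  \sum_(x in A :|: B) w x <= \sum_(x in A) w x + \sum_(x in B) w x.
Proof.
move=> w0; rewrite big_mkcond [X in _ <= X + _]big_mkcond /=.
rewrite [X in _ <= _ + X]big_mkcond -big_split /=; apply: ler_sum => x _.
rewrite inE; case: (x \in A); case: (x \in B);
  by rewrite /= ?addr0 ?add0r ?lerDl.
Qed.

Lemma sum_subset_le (R : realType) (F : finType) (w : F -> R) (P Q : pred F) :
  (forall x, 0 <= w x) -> (forall x, P x -> Q x) ->
  \sum_(x | P x) w x <= \sum_(x | Q x) w x.
Proof.
move=> w0 PQ; rewrite big_mkcond [X in _ <= X]big_mkcond /=.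
by apply: ler_sum => x _; case: ifP => [/PQ -> //|_]; case: ifP.
Qed.

Lemma blocks_hyperfinite (R : realType) (F : fin_graph) (K : nat) (c : R)
    (w : F -> R) (J : eqType) (b : F -> J) (P : {set F}) :
  0 <= c -> (forall x, 0 <= w x) ->
  (forall x y, x \in P -> y \in P -> fadj x y -> b x = b y) ->
  (forall j, exists Y : {set F}, [/\ Y \subset [set x in P | b x == j],
     \sum_(x in Y) w x <= c * \sum_(x in P | b x == j) w x
   & components_le (Y :|: ~: [set x in P | b x == j]) K]) ->
  exists Y : {set F}, \sum_(x in Y) w x <= c * \sum_(x : F) w x
    /\ components_le (Y :|: ~: P) K.
Proof.
move=> c0 w0 bP /choice [f fP].
pose B j := [set x in P | b x == j]; pose Y := [set x | x \in f (b x)].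
have fB x j : x \in f j -> x \in B j.
  by case: (fP j) => /fintype.subsetP fj _ _ /fj.
exists Y; split.
  (* [J] need not be finite, so the sums are split by the block [B (b x)], an element of the finite
     type [{set F}], instead of by the label [b x]. *)
  rewrite (partition_big (fun x => B (b x)) predT) //=.
  rewrite [X in _ <= c * X](partition_big (fun x => B (b x)) predT) //=.
  rewrite mulr_sumr; apply: ler_sum => C _.
  have [/existsP [x0 /andP [x0Y /eqP x0C]]|none] :=
    boolP [exists x, (x \in Y) && (B (b x) == C)]; last first.
    rewrite big_pred0 ?mulr_ge0 ?sumr_ge0 // => x.
    by apply/negbTE; apply: contra none => xY; apply/existsP; exists x.
  have x0f : x0 \in f (b x0) by move: x0Y; rewrite inE.
  (* Labels attained on [P] can be recovered from their blocks, because a block containing a point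
     of [P] is nonempty. *)
  have sameb x : x \in P -> B (b x) = B (b x0) -> b x = b x0.
    move=> xP /finset.setP /(_ x); rewrite !inE xP eqxx /=.
    by move/esym/eqP.
  apply: le_trans (_ : \sum_(x in f (b x0)) w x <= _).
    apply: sum_subset_le => // x /andP []; rewrite inE => xf /eqP xC.
    rewrite -(sameb x) // ?xC ?x0C //.
    by move: (fB _ _ xf); rewrite inE => /andP [].
  case: (fP (b x0)) => _ le _; apply: le_trans le _.
  rewrite ler_wpM2l //; apply: sum_subset_le => // x /andP [_ /eqP ->].
  by rewrite x0C.
move=> x; rewrite !inE negb_or negbK => /andP [xf xP].
have xY : x \notin f (b x) :|: ~: B (b x).
  by rewrite !inE xP eqxx orbF.
case: (fP (b x)) => _ _ /(_ _ xY); apply: leq_trans.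
apply/subset_leq_card/fintype.subsetP => y; rewrite !inE => xy.
have Px : (x \in P) && (b x == b x) by rewrite xP eqxx.
apply: (proj1 (@connect_restrict _ _ _
  (fun a => (a \in P) && (b a == b x)) x y _ Px xy)).
move=> a a' /andP [aP /eqP ax]; rewrite /del_adj /= !inE !negb_or !negbK.
move=> /and3P [/andP [af _] /andP [af' a'P] aa'].
have a'x : b a' = b x by rewrite -(bP a a').
by rewrite aP a'P ax a'x eqxx aa' -{1}ax -a'x af af'.
Qed.

(** Counting is turned into weighing: [Y] weighs at most [r * m * #|Y|], while [A] weighs at least
    [m * #|A|]. *)
Lemma bounded_ratio_sum_le (R : realType) (F : finType)
    (eps m r : R) (w : F -> R) (A Y : {set F}) :
  0 <= eps -> 0 <= m -> 0 <= r -> Y \subset A ->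
  (forall x, x \in A -> m <= w x <= r * m) ->
  #|Y|%:R <= eps * #|A|%:R ->
  \sum_(x in Y) w x <= r * eps * \sum_(x in A) w x.
Proof.
move=> eps0 m0 r0 /fintype.subsetP YA wA cY.
apply: le_trans (_ : \sum_(x in Y) r * m <= _).
  by apply: ler_sum => x /YA /wA /andP [].
rewrite sumr_const -[_ *+ _]mulr_natr -!mulrA.
rewrite ler_wpM2l // [_ * #|_|%:R]mulrC.
apply: le_trans (ler_wpM2r m0 cY) _; rewrite -mulrA ler_wpM2l //.
rewrite mulr_natl -sumr_const; apply: ler_sum => x.
by move/wA => /andP [].
Qed.

(** * Levels of the weight and the vertices to delete *)

Lemma exists_level (R : realType) (M : nat) (u t : R) :
  (1 < M)%N -> 0 < u -> u <= t ->
  exists l : nat, u * M%:R ^+ l <= t < u * M%:R ^+ l.+1.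
Proof.
move=> M1 u0 ut; have t0 : 0 <= t / u.
  by rewrite divr_ge0 ?(ltW u0) // (le_trans _ ut) // ltW.
have /andP [lo hi] := Num.Theory.truncn_itv t0.
set n := Num.truncn _ in lo hi.
have n0 : (0 < n)%N.
  rewrite -ltnS -(ltr_nat R); apply: le_lt_trans hi.
  by rewrite ler_pdivlMr // mul1r.
(* Rounding [t / u] down to [n] loses nothing, as the powers of [M] are integers. *)
exists (trunc_log M n); apply/andP; split.
  rewrite mulrC -ler_pdivlMr // (le_trans _ lo) //.
  by rewrite -natrX ler_nat trunc_logP.
rewrite mulrC -ltr_pdivrMr // (lt_le_trans hi) //.
by rewrite -natrX ler_nat trunc_log_ltn.
Qed.

(** Averaging: were all [L] shifts too expensive, their costs would add up to more than the total
    weight, though each [x] is counted for at most one [s < L]. *)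
Lemma sparse_residue (R : realType) (F : finType) (w : F -> R) (l : F -> nat)
    (L : nat) : (0 < L)%N -> (forall x, 0 <= w x) ->
  exists s : nat, \sum_(x | (L %| l x + s)%N) w x <= L%:R^-1 * \sum_x w x.
Proof.
move=> L0 w0; set W := \sum_x w x.
have [/existsP [s sW]|/existsPn none] :=
  boolP [exists s : 'I_L, \sum_(x | (L %| l x + s)%N) w x <= L%:R^-1 * W].
  by exists s.
have: \sum_(s < L) L%:R^-1 * W <
      \sum_(s < L) \sum_(x | (L %| l x + s)%N) w x.
  apply: ltr_sum => [|s _]; last by rewrite ltNge none.
  by apply/hasP; exists (Ordinal L0) => //; rewrite mem_index_enum.
rewrite sumr_const card_ord -[X in X < _]mulr_natl mulrA divff ?pnatr_eq0
  -?lt0n // mul1r.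
rewrite ltNge (exchange_big_dep predT) //=; case/negP; apply: ler_sum => x _.
have [/existsP [s0 s0P]|/existsPn nos] :=
  boolP [exists s : 'I_L, (L %| l x + s)%N].
  rewrite (big_pred1 s0) // => s; apply/idP/eqP => [sP|-> //].
  apply/val_inj; rewrite -[LHS](modn_small (ltn_ord s)).
  rewrite -[RHS](modn_small (ltn_ord s0)); apply/eqP.
  by rewrite -(eqn_modDl (l x)) (eqP sP) (eqP s0P).
by rewrite big_pred0 // => s; apply/negbTE/nos.
Qed.

(** Each [y] in [Y] charges its weight to a heavy neighbour [x], which pays at most [w x / M%:R] for
    each of its at most [d] neighbours. *)
Lemma steep_vertices (R : realType) (F : fin_graph) (d M : nat) (w : F -> R)
    (Y : {set F}) : (0 < M)%N -> (forall x, 0 <= w x) ->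
  (forall x : F, #|fadj x| <= d)%N ->
  (forall y, y \in Y -> exists2 x, fadj x y & M%:R * w y <= w x) ->
  \sum_(y in Y) w y <= d%:R / M%:R * \sum_x w x.
Proof.
move=> M0 w0 deg steep.
have M0' : 0 < M%:R :> R by rewrite ltr0n.
apply: le_trans (_ : \sum_(y in Y) \sum_(x | fadj x y) w x / M%:R <= _).
  apply: ler_sum => y /steep [x xy le]; rewrite (bigD1 x) //= ler_wpDr //.
    by apply: sumr_ge0 => z _; rewrite divr_ge0 // ltW.
  by rewrite ler_pdivlMr // mulrC.
rewrite (exchange_big_dep predT) //= mulr_sumr; apply: ler_sum => x _.
apply: le_trans (_ : \sum_(y | fadj x y) w x / M%:R <= _).
  by apply: sum_subset_le => [y|y /andP []] //; rewrite divr_ge0 // ltW.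
rewrite sumr_const -[_ *+ _]mulr_natl mulrCA [leRHS]mulrC.
rewrite ler_wpM2l // ler_wpM2r ?invr_ge0 ?ler_nat ?ltW //.
Qed.

(** The three terms of the bound pay, in order, for the steep vertices [S], the sparse levels [T]
    and the cuts inside the blocks; the zero-weight set [Z] is free. *)
Lemma weighted_of_hyperfinite (R : realType) (F : fin_graph) (d M L K : nat)
    (eps : R) (w : F -> R) :
  (1 < M)%N -> (0 < L)%N -> 0 <= eps -> (forall x : F, #|fadj x| <= d)%N ->
  (forall A : {set F}, exists Y : {set F},
    [/\ Y \subset A, #|Y|%:R <= eps * #|A|%:R
      & components_le (Y :|: ~: A) K]) ->
  (forall x, 0 <= w x) ->
  exists2 Y : {set F},
    \sum_(x in Y) w x <= (d%:R / M%:R + L%:R^-1 + M%:R ^+ L * eps) * \sum_x w x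
    & components_le Y K.
Proof.
move=> M1 L0 eps0 deg hyp w0.
have M0 : 0 < M%:R :> R by rewrite ltr0n ltnW.
have MX k : 0 < M%:R ^+ k :> R by rewrite exprn_gt0.
have MXle k k' : (k <= k')%N -> M%:R ^+ k <= M%:R ^+ k' :> R.
  by move=> kk'; rewrite ler_weXn2l // ler1n ltnW.
(* The minimum of 1 and the positive weights; the 1 keeps [u] positive even if all weights
   vanish. *)
pose u := \big[Order.min/1]_(x | 0 < w x) w x.
have u0 : 0 < u by exact: lt_bigmin.
have /choice [l lP] (x : F) : exists l : nat, 0 < w x ->
    u * M%:R ^+ l <= w x < u * M%:R ^+ l.+1.
  have [wx|] := boolP (0 < w x); last by exists 0%N.
  have [|l lx] := @exists_level R M u (w x) M1 u0; last by exists l.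
  exact: bigmin_le_cond.
have [s sT] := sparse_residue l L0 w0.
pose Z := [set x | w x == 0].
pose S := [set y | [exists x, fadj x y && (M%:R * w y <= w x)]].
pose T := [set x | (L %| l x + s)%N].
pose P := ~: (Z :|: S :|: T).
pose b x := ((l x + s) %/ L)%N.
have PP x : x \in P -> [/\ 0 < w x, x \notin S & ~~ (L %| l x + s)%N].
  rewrite finset.in_setC !finset.in_setU !negb_or.
  move=> /andP [/andP [xZ xS] xT]; split=> //.
    by rewrite lt0r w0 andbT; move: xZ; rewrite inE.
  by move: xT; rewrite inE.
(* If [y] were two levels above [x], it would weigh at least [M] times as much, and [x] would lie in
   [S]. *)
have jump x y : x \in P -> y \in P -> fadj x y -> (l y <= (l x).+1)%N.
  move=> /PP [wx xS _] /PP [wy _ _] xy; rewrite leqNgt; apply: contra xS => lt.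
  rewrite inE; apply/existsP; exists y; rewrite fadj_sym xy /=.
  have /andP [_ /ltW hi] := lP x wx; have /andP [lo _] := lP y wy.
  apply: le_trans lo; apply: le_trans (ler_wpM2l (ltW M0) hi) _.
  by rewrite mulrCA -exprS ler_wpM2l ?MXle // ltW.
(* Going up one level changes the block only if [l y + s] is a multiple of [L], and then [y] would
   lie in [T]. *)
have b_le x y : x \in P -> y \in P -> fadj x y -> (b y <= b x)%N.
  move=> xP yP xy; have := jump _ _ xP yP xy.
  rewrite leq_eqVlt => /orP [/eqP e|]; last first.
    by rewrite ltnS => le; rewrite leq_div2r // leq_add2r.
  have [_ _] := PP y yP; rewrite /b e addSn divnS // => /negbTE ->.
  by rewrite add0n.
have [||||Y [wY compY]] := @blocks_hyperfinite R F K (M%:R ^+ L * eps) w _ b P.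
- by rewrite mulr_ge0 // ltW.
- exact: w0.
- move=> x y xP yP xy; apply/eqP; rewrite eqn_leq !b_le //.
  by rewrite fadj_sym.
- move=> j; have [Y [YB cY compY]] := hyp [set x in P | b x == j].
  exists Y; split=> //.
  have -> : \sum_(x in P | b x == j) w x =
      \sum_(x in [set x in P | b x == j]) w x.
    by apply: eq_bigl => x; rewrite [RHS]inE.
  (* In block [j] the sum [l x + s] is at least [j * L] and less than [j.+1 * L], which gives this
     lower bound and the ratio [M ^ L]. Dividing by [M ^ s] avoids a truncated [j * L - s]. *)
  apply: (@bounded_ratio_sum_le R F eps
    (u * M%:R ^+ (j * L) / M%:R ^+ s)) => //.
  + by rewrite divr_ge0 ?mulr_ge0 // ltW.
  + exact: ltW.
  + move=> x; rewrite inE => /andP [/PP [wx _ _] /eqP bx].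
    have /andP [lo hi] := lP x wx; apply/andP; split.
      rewrite ler_pdivrMr // (le_trans _ (ler_wpM2r (ltW (MX s)) lo)) //.
      by rewrite -mulrA -exprD ler_wpM2l ?(ltW u0) // MXle // -bx leq_trunc_div.
    rewrite mulrA ler_pdivlMr //.
    apply: le_trans (ler_wpM2r (ltW (MX s)) (ltW hi)) _.
    rewrite mulrCA -mulrA -!exprD ler_wpM2l ?(ltW u0) // MXle //.
    by rewrite addSn -mulSn -bx ltn_ceil.
exists (Y :|: ~: P) => //; rewrite finset.setCK.
apply: le_trans (sum_union_le _ _ w0) _.
rewrite [leRHS]mulrDl [leRHS]addrC; apply: lerD => //.
apply: le_trans (sum_union_le _ _ w0) _.
rewrite mulrDl; apply: lerD; last first.
  by apply: le_trans sT; apply: sum_subset_le => // x; rewrite inE.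
apply: le_trans (sum_union_le _ _ w0) _.
rewrite big1 ?add0r => [|x]; last by rewrite inE => /eqP.
apply: steep_vertices => //; first exact: ltnW.
by move=> y; rewrite inE => /existsP [x /andP [? ?]]; exists x.
Qed.

(** * Choice of the constants *)

Lemma fsubgraph_degree (G : graph) (d : nat) (H : fsubgraph G)
    (x : fin_graph_of_sub H) : degree_le G d -> (#|fadj x| <= d)%N.
Proof.
move=> /(_ (val x)) deg.
pose B : {fset G} := [fset val y | y in fadj x]%fset.
have BN : ([set` B] `<=` neighbours (val x))%classic.
  by move=> _ /= /imfsetP [y /= xy ->]; exact: sub_adjP.
have := geq_card_fset_set (card_le_trans (subset_card_le BN) deg).
rewrite set_fsetK; apply: leq_trans.
by rewrite card_imfset ?cardE /=; last exact: val_inj.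
Qed.

Theorem theorem1 (R : realType) (G : graph) (hinf : infinite_graph G)
    (hdeg : exists2 d : nat, (0 < d)%N & degree_le G d)
    (hula : graph_ULA R G) : property_A R G.
Proof.
have [d d0 deg] := hdeg; move=> eps eps0.
(* [M], [L] and [e] make each of the three terms of the bound at most [eps / 3]; [.+2] also ensures
   [1 < M]. They depend on [d] and [eps] only, so [K] is uniform in the subgraph and the weight. *)
pose M := (Num.truncn (3 * d%:R / eps)).+2.
pose L := (Num.truncn (3 / eps)).+1.
have M0 : 0 < M%:R :> R by rewrite ltr0n.
have Md : d%:R / M%:R <= eps / 3.
  have : 3 * d%:R / eps <= M%:R.
    by apply/ltW/(lt_trans (Num.Theory.truncnS_gt _)); rewrite ltr_nat.
  by rewrite !(ler_pdivrMr, ler_pdivlMr) //; lra.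
have LE : L%:R^-1 <= eps / 3.
  rewrite -[eps / 3]invrK invf_div lef_pV2 ?posrE ?ltr0n ?divr_gt0 //.
  exact/ltW/Num.Theory.truncnS_gt.
pose e := eps / 3 / M%:R ^+ L.
have e0 : 0 < e by rewrite !divr_gt0 ?exprn_gt0.
have [K K0 ula] := hula e e0; exists K => // F [H [H0 ->]] w w0.
have [Y wY compY] := weighted_of_hyperfinite (isT : (1 < M)%N)
  (isT : (0 < L)%N) (ltW e0) (fun x => fsubgraph_degree x deg)
  (greedy_hyperfinite (ltW e0) (ULA_induced ula)) w0.
exists Y => //; apply: le_trans wY _; rewrite ler_wpM2r ?sumr_ge0 //.
rewrite /e [M%:R ^+ L * _]mulrC divfK ?expf_neq0 ?gt_eqF //.
by lra.
Qed.
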